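(* Let $\mathfrak{g}$ be a Leibniz algebra, $E$ a vector space that contains $\mathfrak{g}$ as a subspace and $V$ a complement of $\mathfrak{g}$ in $E$. Then: (1) $\equiv$ is an equivalence relation on the set $\mathcal{L}\mathcal{Z}(\mathfrak{g},V)$ of all Leibniz extending structures of $\mathfrak{g}$ through $V$. Writing $\mathcal{H}\mathcal{L}^2_{\mathfrak{g}}(V,\mathfrak{g}):=\mathcal{L}\mathcal{Z}(\mathfrak{g},V)/\equiv$, the map $$\mathcal{H}\mathcal{L}^2_{\mathfrak{g}}(V,\mathfrak{g})\to\mathrm{ExtdL}(E,\mathfrak{g}),\qquad \overline{(\triangleleft,\triangleright,\leftharpoonup,\rightharpoonup,f,\{-,-\})}\mapsto(\mathfrak{g}\ltimes V,[-,-])$$ is bijective, where the overline denotes the equivalence class via $\equiv$. (2) $\approx$ is an equivalence relation on $\mathcal{L}\mathcal{Z}(\mathfrak{g},V)$. Writing $\mathcal{H}\mathcal{L}^2(V,\mathfrak{g}):=\mathcal{L}\mathcal{Z}(\mathfrak{g},V)/\approx$, the map $$\mathcal{H}\mathcal{L}^2(V,\mathfrak{g})\to\mathrm{ExtdL}'(E,\mathfrak{g}),\qquad \overline{\overline{(\triangleleft,\triangleright,\leftharpoonup,\rightharpoonup,f,\{-,-\})}}\mapsto(\mathfrak{g}\ltimes V,[-,-])$$ is bijective, where the double overline denotes the equivalence class via $\approx$. Here $(\mathfrak{g}\ltimes V,[-,-])$ stands for the class of the Leibniz bracket on $E$ obtained by transporting the unified product bracket along the linear isomorphism $\mathfrak{g}\times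 V\to E$, $(g,x)\mapsto g+x$.
   Context: All vector spaces, linear and bilinear maps are over an arbitrary field $k$. A Leibniz algebra is a vector space $\mathfrak{g}$ with a bilinear map $[-,-]$ satisfying $[g,[h,l]]=[[g,h],l]-[[g,l],h]$. A complement of a subspace $\mathfrak{g}$ in $E$ is a subspace $V$ with $E=\mathfrak{g}+V$, $\mathfrak{g}\cap V=0$; $\pi:E\to V$ denotes the projection along $\mathfrak{g}$. Extending structures. An extending datum of $\mathfrak{g}$ through $V$ is a system $\Omega(\mathfrak{g},V)=(\triangleleft,\triangleright,\leftharpoonup,\rightharpoonup,f,\{-,-\})$ of six bilinear maps $\triangleleft:V\times\mathfrak{g}\to V$, $\triangleright:V\times\mathfrak{g}\to\mathfrak{g}$, $\leftharpoonup:\mathfrak{g}\times V\to\mathfrak{g}$, $\rightharpoonup:\mathfrak{g}\times V\to V$, $f:V\times V\to\mathfrak{g}$, $\{-,-\}:V\times V\to V$. Then $\mathfrak{g}\ltimes V$ denotes $\mathfrak{g}\times V$ with the bracket $$[(g,x),(h,y)]=\bigl([g,h]+x\triangleright h+g\leftharpoonup y+f(x,y),\ \{x,y\}+x\triangleleft h+g\rightharpoonup y\bigr).$$ The datum is a Leibniz extending structure of $\mathfrak{g}$ through $V$ if this bracket makes $\mathfrak{g}\ltimes V$ a Leibniz algebra (the unified product). Relation $\equiv$ on $\mathcal{L}\mathcal{Z}(\mathfrak{g},V)$: $(\triangleleft,\triangleright,\leftharpoonup,\rightharpoonup,f,\{-,-\})\equiv(\triangleleft',\triangleright',\leftharpoonup',\rightharpoonup',f',\{-,-\}')$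 if there are a linear map $r:V\to\mathfrak{g}$ and a linear automorphism $v$ of $V$ such that for all $g\in\mathfrak{g}$, $x,y\in V$: $x\triangleleft g=v^{-1}(v(x)\triangleleft' g)$; $g\rightharpoonup x=v^{-1}(g\rightharpoonup' v(x))$; $x\triangleright g=[r(x),g]+v(x)\triangleright' g-r\bigl(v^{-1}(v(x)\triangleleft' g)\bigr)$; $g\leftharpoonup x=[g,r(x)]+g\leftharpoonup' v(x)-r\bigl(v^{-1}(g\rightharpoonup' v(x))\bigr)$; $\{x,y\}=v^{-1}\bigl(r(x)\rightharpoonup' v(y)+v(x)\triangleleft' r(y)+\{v(x),v(y)\}'\bigr)$; $f(x,y)=[r(x),r(y)]+r(x)\leftharpoonup' v(y)+v(x)\triangleright' r(y)+f'(v(x),v(y))-r\bigl(v^{-1}(r(x)\rightharpoonup' v(y)+v(x)\triangleleft' r(y)+\{v(x),v(y)\}')\bigr)$. Relation $\approx$ on $\mathcal{L}\mathcal{Z}(\mathfrak{g},V)$: $\triangleleft=\triangleleft'$, $\rightharpoonup=\rightharpoonup'$ and there is a linear map $r:V\to\mathfrak{g}$ such that for all $g\in\mathfrak{g}$, $x,y\in V$: $x\triangleright g=[r(x),g]+x\triangleright' g-r(x\triangleleft' g)$; $g\leftharpoonup x=[g,r(x)]+g\leftharpoonup' x-r(g\rightharpoonup' x)$; $\{x,y\}=r(x)\rightharpoonup' y+x\triangleleft' r(y)+\{x,y\}'$; $f(x,y)=[r(x),r(y)]+r(x)\leftharpoonup' y+x\triangleright' r(y)+f'(x,y)-r\bigl(r(x)\rightharpoonup'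 y+x\triangleleft' r(y)+\{x,y\}'\bigr)$. Classifying sets. Consider all Leibniz algebra structures on $E$ containing $\mathfrak{g}$ (with its given bracket) as a Leibniz subalgebra. Two such structures are called equivalent if there is a Leibniz algebra isomorphism $\varphi:E\to E$ from the first to the second that stabilizes $\mathfrak{g}$ ($\varphi(g)=g$ for all $g\in\mathfrak{g}$); they are called cohomologous if moreover $\varphi$ can be chosen to co-stabilize $V$ ($\pi\circ\varphi=\pi$). $\mathrm{ExtdL}(E,\mathfrak{g})$ (resp. $\mathrm{ExtdL}'(E,\mathfrak{g})$) is the set of equivalence classes for the first (resp. second) relation. *)

(* Defs.v *)
From HB Require Import structures.
Set Warnings "-notation-overridden,-ambiguous-paths".
From mathcomp Require Import all_boot all_algebra.
From mathcomp Require Import boolp classical_sets.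
From Stdlib Require Export RelationClasses.

Set Implicit Arguments.
Unset Strict Implicit.
Unset Printing Implicit Defensive.

Import GRing.Theory.
Local Open Scope ring_scope.

Section Leibniz.
Context {k : fieldType}.

(* The (right) Leibniz identity [x,[y,z]] = [[x,y],z] - [[x,z],y]. *)
Definition leibniz_id {U : lmodType k} (b : U -> U -> U) : Prop :=
  forall x y z : U, b x (b y z) = b (b x y) z - b (b x z) y.

Record leibniz (U : lmodType k) := Leibniz {
  bracket :> {bilinear U -> U -> U};
  leibnizP : leibniz_id bracket }.

(* An isomorphism from (U, b) to (U', b'). *)
Definition leibniz_iso {U U' : lmodType k} (b : leibniz U) (b' : leibniz U')
    (phi : {linear U -> U'}) : Prop :=
  bijective phi /\ forall x y : U, phi (b x y) = b' (phi x) (phi y).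

End Leibniz.

Section Quotient.
Context {T : Type}.

(* The set of classes of R.  No hypothesis on R is bundled; when R is an
   equivalence relation this is the usual quotient set T / R. *)
Record quotient (R : T -> T -> Prop) := Quotient {
  members : set T;
  membersP : exists x : T, members = [set y | R x y]%classic }.

Definition class_of (R : T -> T -> Prop) (x : T) : quotient R :=
  @Quotient R [set y | R x y]%classic (ex_intro _ x erefl).

End Quotient.

Section ExtendingStructures.
Context {k : fieldType} {g V : lmodType k}.

Record extending_datum := ExtendingDatum {
  rtri : {bilinear V -> g -> V};  (* rtri x g  is  x \triangleleft g      *)
  ltri : {bilinear V -> g -> g};  (* ltri x g  is  x \triangleright g     *)
  rhar : {bilinear g -> V -> g};  (* rhar g x  is  g \leftharpoonup x     *)
  lhar : {bilinear g -> V -> V};  (* lhar g x  is  g \rightharpoonup x    *)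
  coc  : {bilinear V -> V -> g};  (* coc x y   is  f(x, y)                *)
  vbr  : {bilinear V -> V -> V}   (* vbr x y   is  {x, y}                 *)
}.

Definition unified_bracket (b : leibniz g) (O : extending_datum)
    (p q : g * V) : g * V :=
  (b p.1 q.1 + ltri O p.2 q.1 + rhar O p.1 q.2 + coc O p.2 q.2,
   vbr O p.2 q.2 + rtri O p.2 q.1 + lhar O p.1 q.2).

Lemma unified_bracket_bilinear (b : leibniz g) (O : extending_datum) :
  bilinear_for *:%R *:%R (unified_bracket b O).
Proof.
have sum3 (U : lmodType k) (a : k) (u1 u2 v1 v2 w1 w2 : U) :
    (a *: u1 + u2) + (a *: v1 + v2) + (a *: w1 + w2)
    = a *: (u1 + v1 + w1) + (u2 + v2 + w2).
  by rewrite !scalerDr (addrACA (a *: u1)) (addrACA (a *: u1 + a *: v1)).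
have sum4 (U : lmodType k) (a : k) (u1 u2 v1 v2 w1 w2 z1 z2 : U) :
    (a *: u1 + u2) + (a *: v1 + v2) + (a *: w1 + w2) + (a *: z1 + z2)
    = a *: (u1 + v1 + w1 + z1) + (u2 + v2 + w2 + z2).
  by rewrite sum3 (addrACA (a *: _)) -scalerDr.
split=> [] [h y] a [h1 y1] [h2 y2]; congr pair => /=.
- by rewrite !linearPl sum4.
- by rewrite !linearPl sum3.
- by rewrite !linearPr sum4.
- by rewrite !linearPr sum3.
Qed.

HB.instance Definition _ (b : leibniz g) (O : extending_datum) :=
  bilinear_isBilinear.Build k (g * V)%type (g * V)%type (g * V)%type
    *:%R *:%R (unified_bracket b O) (unified_bracket_bilinear b O).

(* The set LZ(g, V) of Leibniz extending structures of (g, b) through V. *)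
Record LZ (b : leibniz g) := LeibnizExtending {
  datum :> extending_datum;
  datumP : leibniz_id (unified_bracket b datum) }.

Definition unified_product (b : leibniz g) (O : LZ b) : leibniz (g * V)%type :=
  @Leibniz k (g * V)%type (unified_bracket b O) (datumP O).

(* The relation \equiv; vi is the inverse of the automorphism v. *)
Definition LZ_equiv (b : leibniz g) (O O' : LZ b) : Prop :=
  exists (r : {linear V -> g}) (v : {linear V -> V}) (vi : V -> V),
    [/\ cancel v vi, cancel vi v &
    forall (h : g) (x y : V),
    [/\ rtri O x h = vi (rtri O' (v x) h),
        lhar O h x = vi (lhar O' h (v x)),
        ltri O x h = b (r x) h + ltri O' (v x) h - r (vi (rtri O' (v x) h)),
        rhar O h x = b h (r x) + rhar O' h (v x) - r (vi (lhar O' h (v x))) &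
        vbr O x y =
          vi (lhar O' (r x) (v y) + rtri O' (v x) (r y) + vbr O' (v x) (v y))
     /\ coc O x y =
          b (r x) (r y) + rhar O' (r x) (v y) + ltri O' (v x) (r y)
          + coc O' (v x) (v y)
          - r (vi (lhar O' (r x) (v y) + rtri O' (v x) (r y)
                   + vbr O' (v x) (v y)))]].

(* The relation \approx. *)
Definition LZ_approx (b : leibniz g) (O O' : LZ b) : Prop :=
  [/\ forall (x : V) (h : g), rtri O x h = rtri O' x h,
      forall (h : g) (x : V), lhar O h x = lhar O' h x &
  exists r : {linear V -> g}, forall (h : g) (x y : V),
    [/\ ltri O x h = b (r x) h + ltri O' x h - r (rtri O' x h),
        rhar O h x = b h (r x) + rhar O' h x - r (lhar O' h x),
        vbr O x y = lhar O' (r x) y + rtri O' x (r y) + vbr O' x y &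
        coc O x y =
          b (r x) (r y) + rhar O' (r x) y + ltri O' x (r y) + coc O' x y
          - r (lhar O' (r x) y + rtri O' x (r y) + vbr O' x y)]].

End ExtendingStructures.

Arguments extending_datum {k} g V.
Arguments LZ {k g} V b.

(* A subspace of E is a predicate G on E together with a type g of its
   elements, g : subLmodType G, with inclusion val : g -> E. *)
Section Extensions.
Context {k : fieldType} {E : lmodType k}.

Definition complement (G W : pred E) : Prop :=
  (forall e : E, exists x y : E, [/\ x \in G, y \in W & e = x + y])
  /\ (forall e : E, e \in G -> e \in W -> e = 0).

Context {G W : pred E} {g : subLmodType G} {V : subLmodType W}.

Definition glue (p : g * V) : E := val p.1 + val p.2.

(* The decomposition of e along E = g + V; the default (0, 0) is not used
   when W is a complement of G. *)
Definition split_sum (e : E) : g * V := xget (0, 0) [set p | glue p = e]%classic.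

(* \pi : E -> V *)
Definition proj (e : E) : V := (split_sum e).2.

(* Leibniz algebra structures on E with (g, b) as a Leibniz subalgebra. *)
Record extension (b : leibniz g) := Extension {
  ext_leibniz :> leibniz E;
  extensionP : forall x y : g, ext_leibniz (val x) (val y) = val (b x y) }.

Definition stabilizes (phi : E -> E) : Prop :=
  forall x : g, phi (val x) = val x.

Definition costabilizes (phi : E -> E) : Prop :=
  forall e : E, proj (phi e) = proj e.

Definition ext_equivalent (b : leibniz g) (c c' : extension b) : Prop :=
  exists phi : {linear E -> E}, leibniz_iso c c' phi /\ stabilizes phi.

Definition ext_cohomologous (b : leibniz g) (c c' : extension b) : Prop :=
  exists phi : {linear E -> E},
    [/\ leibniz_iso c c' phi, stabilizes phi & costabilizes phi].

(* Transport of the unified product along glue : g * V -> E. *)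
Definition transported_bracket (b : leibniz g) (O : LZ V b) (e e' : E) : E :=
  glue (unified_product O (split_sum e) (split_sum e')).

Section Transport.
Hypothesis compGW : complement G W.

Lemma glue_linear : linear glue.
Proof.
by move=> a [x y] [x' y']; rewrite /glue /= !linearP /= scalerDr addrACA.
Qed.

Lemma glueK : cancel glue split_sum.
Proof.
move=> [x y]; apply: xget_unique => //= -[x' y'] eq_e.
have eq_d : val (x' - x) = val (y - y').
  apply/eqP; rewrite !raddfB /= subr_eq addrAC eq_sym subr_eq.
  by move: eq_e; rewrite /glue /= => ->; rewrite addrC.
have d0 : val (x' - x) = 0.
  by apply: compGW.2; [exact: valP | rewrite eq_d; exact: valP].
have xx' : x' - x = 0 by apply: val_inj; rewrite d0 raddf0.
have yy' : y - y' = 0 by apply: val_inj; rewrite -eq_d d0 raddf0.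
by rewrite -(subrK x x') xx' add0r -(subrK y' y) yy' add0r.
Qed.

Lemma split_sumK : cancel split_sum glue.
Proof.
move=> e; apply: (@xgetPex _ (0, 0) [set p | glue p = e]%classic).
have [x [y [Gx Wy ->]]] := compGW.1 e.
by exists (Sub x Gx, Sub y Wy); rewrite /glue /= !SubK.
Qed.

Lemma split_sum_linear : linear split_sum.
Proof.
move=> a e e'; apply: (can_inj glueK).
by rewrite glue_linear !split_sumK.
Qed.

Lemma transported_bracket_bilinear (b : leibniz g) (O : LZ V b) :
  bilinear_for *:%R *:%R (transported_bracket O).
Proof.
split=> e a e1 e2; rewrite /transported_bracket split_sum_linear.
  by rewrite linearPl glue_linear.
by rewrite linearPr glue_linear.
Qed.

Definition transported_bilinear (b : leibniz g) (O : LZ V b) :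
    {bilinear E -> E -> E} :=
  HB.pack (transported_bracket O)
    (bilinear_isBilinear.Build k E E E *:%R *:%R (transported_bracket O)
       (transported_bracket_bilinear O)).

Lemma transported_leibniz_id (b : leibniz g) (O : LZ V b) :
  leibniz_id (transported_bilinear O).
Proof.
have glueB p q : glue (p - q) = glue p - glue q.
  have -> : p - q = (-1) *: q + p by rewrite scaleN1r addrC.
  by rewrite glue_linear scaleN1r addrC.
move=> x y z; rewrite /= /transported_bracket !glueK -glueB.
by congr glue; exact: (leibnizP (unified_product O)).
Qed.

Lemma transported_extends (b : leibniz g) (O : LZ V b) (x y : g) :
  transported_bilinear O (val x) (val y) = val (b x y).
Proof.
have gl (z : g) : val z = glue (z, 0) by rewrite /glue /= raddf0 addr0.
rewrite /= /transported_bracket !gl !glueK; congr glue.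
by congr pair => /=; rewrite !(linear0l, linear0r) !addr0.
Qed.

(* (g \ltimes V, [-,-]) as a Leibniz algebra structure on E. *)
Definition unified_extension (b : leibniz g) (O : LZ V b) : extension b :=
  @Extension b (Leibniz (transported_leibniz_id O)) (transported_extends O).

End Transport.

End Extensions.

Arguments stabilizes {k E G} g phi.
Arguments costabilizes {k E G W} g V phi.
Arguments ext_equivalent {k E G g b} c c'.
Arguments ext_cohomologous {k E G W g} V {b} c c'.

(* HL2_g(V, g), HL2(V, g), ExtdL(E, g) and ExtdL'(E, g). *)
Definition HL2g {k : fieldType} {g : lmodType k} (V : lmodType k)
  (b : leibniz g) := quotient (@LZ_equiv k g V b).

Definition HL2 {k : fieldType} {g : lmodType k} (V : lmodType k)
  (b : leibniz g) := quotient (@LZ_approx k g V b).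

Definition ExtdL {k : fieldType} {E : lmodType k} {G : pred E}
  {g : subLmodType G} (b : leibniz g) := quotient (@ext_equivalent k E G g b).

Definition ExtdL' {k : fieldType} {E : lmodType k} {G W : pred E}
  {g : subLmodType G} (V : subLmodType W) (b : leibniz g) :=
  quotient (@ext_cohomologous k E G W g V b).

(* Main.v *)
(** Since $\varphi$ fixes $\mathfrak g$ pointwise, in the coordinates
    $E\cong\mathfrak g\times V$ it is $(h,x)\mapsto(h+r(x),v(x))$, where
    $r:V\to\mathfrak g$ and $v:V\to V$ are linear; it is invertible iff $v$ is,
    and co-stabilizes $V$ iff $v=\mathrm{id}$.  Such a map is a morphism of
    unified products exactly when the six identities defining $\equiv$ (resp.
    $\approx$) hold, so these relations are the pull-backs of equivalence and
    cohomology of extensions.  Conversely, the components of any extension in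
    these coordinates form an extending structure, and the
    extension is its transport. *)
From HB Require Import structures.
Require Import Defs.
From mathcomp Require Import all_boot all_algebra.
From mathcomp Require Import boolp classical_sets.

Set Implicit Arguments.
Unset Strict Implicit.
Unset Printing Implicit Defensive.

Import GRing.Theory.
Local Open Scope ring_scope.

(** * Quotient sets and the maps induced between them *)

Section QuotientTheory.
Context {T : Type} (R : T -> T -> Prop).

Lemma quotient_inj : injective (@members T R).
Proof.
case=> [A hA] [B hB] /= eqAB; case: B / eqAB in hB *.
by rewrite (Prop_irrelevance hA hB).
Qed.

Lemma class_of_surj (q : quotient R) : exists x : T, q = class_of R x.
Proof. by have [x qx] := membersP q; exists x; exact: quotient_inj. Qed.

Lemma class_ofP (eqR : Equivalence R) (x y : T) :
  class_of R x = class_of R y <-> R x y.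
Proof.
split=> [/(congr1 (@members T R)) /= /seteqP[_ sub] | Rxy].
  by apply: sub => /=; reflexivity.
apply: quotient_inj; apply/seteqP; split=> z /= Rz; last by transitivity y.
by transitivity x => //; symmetry.
Qed.

End QuotientTheory.

(** Common core of both bijections. Pulling [S] back along [f] makes [R] an equivalence and the
    induced map well defined and injective; reaching every element of [B] up to [S] makes it
    onto. *)
Lemma quotient_bijection (A B : Type) (R : A -> A -> Prop) (S : B -> B -> Prop)
    (f : A -> B) :
  Equivalence S -> (forall x y, R x y <-> S (f x) (f y)) ->
  (forall c, exists x, S (f x) c) ->
  Equivalence R /\
  exists F : quotient R -> quotient S,
    (forall x, F (class_of R x) = class_of S (f x)) /\ bijective F.
Proof.
move=> eqS RS surj.
have eqR : Equivalence R.
  split=> [x|x y|x y z]; rewrite !RS; first by reflexivity.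
    by move=> ?; symmetry.
  by move=> ? ?; transitivity (f y).
split=> //.
(* Both maps go through chosen representatives; [FE] shows that the choice does not affect [F]. *)
pose F q := class_of S (f (sval (cid (class_of_surj (R := R) q)))).
pose F' q :=
  class_of R (sval (cid (surj (sval (cid (class_of_surj (R := S) q)))))).
have FE x : F (class_of R x) = class_of S (f x).
  rewrite /F; case: cid => y /= /(class_ofP eqR) /RS Sxy.
  by apply/(class_ofP eqS); symmetry.
exists F; split=> //; exists F' => q.
  have [x ->] := class_of_surj q; rewrite FE /F'.
  case: cid => c /= /(class_ofP eqS) Sxc; case: cid => y /= Syc.
  by apply/(class_ofP eqR)/RS; transitivity c => //; symmetry.
rewrite /F'; case: cid => c /= ->; case: cid => y /= Syc.
by rewrite FE; apply/(class_ofP eqS).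
Qed.

(** * Packing functions as linear and bilinear maps *)

Section Packing.
Context {k : fieldType} {U U' U'' : lmodType k}.

Lemma ex_linear (f : U -> U') : linear f -> exists F : {linear U -> U'}, F =1 f.
Proof.
move=> lf.
by exists (HB.pack_for {linear U -> U'} f
  (GRing.isLinear.Build k U U' *:%R f lf)).
Qed.

Lemma ex_bilinear (f : U -> U' -> U'') : bilinear_for *:%R *:%R f ->
  exists F : {bilinear U -> U' -> U''}, forall x y, F x y = f x y.
Proof.
move=> bf.
by exists (HB.pack_for {bilinear U -> U' -> U''} f
  (bilinear_isBilinear.Build k U U' U'' *:%R *:%R f bf)).
Qed.

Lemma inverse_linear (f : {linear U -> U'}) (f' : U' -> U) :
  cancel f f' -> cancel f' f -> linear f'.
Proof. by move=> fK f'K a x y; apply: (can_inj fK); rewrite linearP !f'K. Qed.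

End Packing.

(** * Shears of $\mathfrak g\times V$ and the relations $\equiv$, $\approx$ *)

Section Shear.
Context {k : fieldType} {g V : lmodType k} {b : leibniz g}.

Definition shear (r : V -> g) (v : V -> V) (p : g * V) : g * V :=
  (p.1 + r p.2, v p.2).

Definition shear_morphism (O O' : LZ V b) r v :=
  forall p q, shear r v (unified_bracket b O p q)
    = unified_bracket b O' (shear r v p) (shear r v q).

Lemma shear_linear (r : {linear V -> g}) (v : {linear V -> V}) :
  linear (shear r v).
Proof.
move=> a [h x] [h' x']; rewrite /shear /= !linearP; congr pair => /=.
by rewrite scalerDr addrACA.
Qed.

Lemma shear_bij (r : V -> g) (v : V -> V) : bijective v ->
  bijective (shear r v).
Proof.
case=> vi vK viK; exists (fun p => (p.1 - r (vi p.2), vi p.2)) => -[h x].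
  by rewrite /shear /= vK addrK.
by rewrite /shear /= viK subrK.
Qed.

(** By bilinearity it suffices to test the four kinds of pairs from $\mathfrak g$ and $V$; the pair
    $\mathfrak g,\mathfrak g$ gives $[g,h]$ on both sides. With the [r] terms moved to the left, no
    inverse of [v] appears, so the same form serves both relations. *)
Lemma shear_morphismP (O O' : LZ V b) (r : {linear V -> g})
    (v : {linear V -> V}) :
  shear_morphism O O' r v <->
  forall (h : g) (x y : V),
  [/\ v (rtri O x h) = rtri O' (v x) h,
      v (lhar O h x) = lhar O' h (v x),
      ltri O x h + r (rtri O x h) = b (r x) h + ltri O' (v x) h,
      rhar O h x + r (lhar O h x) = b h (r x) + rhar O' h (v x) &
      v (vbr O x y)
        = lhar O' (r x) (v y) + rtri O' (v x) (r y) + vbr O' (v x) (v y)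
   /\ coc O x y + r (vbr O x y)
        = b (r x) (r y) + rhar O' (r x) (v y) + ltri O' (v x) (r y)
          + coc O' (v x) (v y)].
Proof.
split=> [morph h x y | H [h x] [h' y]].
  have := morph (0, x) (h, 0); have := morph (h, 0) (0, x).
  have := morph (0, x) (0, y).
  rewrite /shear /unified_bracket /=.
  rewrite !(linear0, linear0l, linear0r, addr0, add0r).
  move=> [-> ->] [-> ->] [-> ->]; split=> //; split.

    by rewrite addrC addrA addrAC.
  by congr (_ + _); exact: addrAC.
(* Each mixed identity is taken at the $\mathfrak g$-component of one factor and the $V$-component
   of the other. *)
have [_ v2 _ r2 _] := H h y x.
have [v1 _ r1 _ _] := H h' x y.
have [_ _ _ _ [v4 r4]] := H h x y.
rewrite /shear /unified_bracket /=; congr pair; last first.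
  rewrite !linearD /= v1 v2 v4 !(linearDl, linearDr) /= !addrA.
  by rewrite [LHS](ACl (3*4*2*5*1)%AC).
(* The image under [r] of the $V$-component is distributed so that each group is the left side of
   one identity. *)
have -> : b h h' + ltri O x h' + rhar O h y + coc O x y
      + r (vbr O x y + rtri O x h' + lhar O h y)
    = b h h' + (ltri O x h' + r (rtri O x h'))
      + (rhar O h y + r (lhar O h y)) + (coc O x y + r (vbr O x y)).
  by rewrite !linearD /= !addrA [LHS](ACl (1*2*6*3*7*4*5)%AC).
rewrite r1 r2 r4 !(linearDl, linearDr) /= !addrA.
by rewrite [LHS](ACl (1*4*2*6*3*8*5*7*9)%AC).
Qed.

Lemma LZ_equivP (O O' : LZ V b) :
  LZ_equiv O O' <->
  exists (r : {linear V -> g}) (v : {linear V -> V}),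
    bijective v /\ shear_morphism O O' r v.
Proof.
split=> [[r [v [vi [vK viK H]]]] | [r [v [[vi vK viK] /shear_morphismP H]]]].
  exists r, v; split; first by exists vi.
  apply/shear_morphismP => h x y; have [e1 e2 e3 e4 [e5 e6]] := H h x y.
  (* Read backwards, [e1], [e2], [e5] turn the [vi] terms into operations of [O], so the subtracted
     [r] terms cancel; read forwards, they give the identities for [v]. *)
  by rewrite e3 e4 e6 -e1 -e2 -e5 !subrK e1 e2 e5 !viK.
exists r, v, vi; split=> // h x y; have [e1 e2 e3 e4 [e5 e6]] := H h x y.
by rewrite -e1 -e2 -e3 -e4 -e5 -e6 !vK !addrK.
Qed.

Lemma LZ_approxP (O O' : LZ V b) :
  LZ_approx O O' <->
  exists r : {linear V -> g}, shear_morphism O O' r idfun.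
Proof.
split=> [[e1 e2 [r H]] | [r /shear_morphismP H]].
  exists r; apply/shear_morphismP => h x y /=; have [e3 e4 e5 e6] := H h x y.
  by rewrite e1 e2 e3 e4 e6 -e5 !subrK.
(* The first two identities concern only [h] and [x]; [0] fills the third place. *)
split=> [x h | h x |]; [by case: (H h x 0) | by case: (H h x 0) |].
exists r => h x y; have [/= e1 e2 e3 e4 [e5 e6]] := H h x y.
by rewrite -e1 -e2 -e3 -e4 -e5 -e6 !addrK.
Qed.

End Shear.

(** * Equivalence and cohomology of extensions in coordinates *)

Section Extensions.
Context {k : fieldType} {E : lmodType k} {G W : pred E}.
Context {g : subLmodType G} {V : subLmodType W} {b : leibniz g}.

(** Gives symmetry of both relations on extensions, and later the inverse of the component [v] of a
    stabilizing isomorphism. *)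
Lemma stabilizing_iso_inverse (c c' : extension b) (phi : {linear E -> E}) :
  leibniz_iso c c' phi -> stabilizes g phi ->
  exists psi : {linear E -> E},
    [/\ cancel phi psi, cancel psi phi, leibniz_iso c' c psi &
        stabilizes g psi].
Proof.
move=> [[phi' phiK phi'K] mor] stab.
have [psi psiE] := ex_linear (inverse_linear phiK phi'K).
have psiK : cancel phi psi by move=> x; rewrite psiE phiK.
have Kpsi : cancel psi phi by move=> x; rewrite psiE phi'K.
exists psi; split=> //; last by move=> x; rewrite -{1}(stab x) psiK.
split; first by exists phi.
by move=> x y; rewrite -{1}(Kpsi x) -{1}(Kpsi y) -mor psiK.
Qed.

Lemma stabilizing_iso_comp (c1 c2 c3 : extension b)
    (phi psi : {linear E -> E}) :
  leibniz_iso c1 c2 phi -> stabilizes g phi ->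
  leibniz_iso c2 c3 psi -> stabilizes g psi ->
  leibniz_iso c1 c3 (psi \o phi) /\ stabilizes g (psi \o phi).
Proof.
move=> [bij mor] stab [bij' mor'] stab'; split; last first.
  by move=> x /=; rewrite stab stab'.
by split=> [|x y]; [exact: bij_comp | rewrite /= mor mor'].
Qed.

Lemma cohomologous_equivalent (c c' : extension b) :
  ext_cohomologous V c c' -> ext_equivalent c c'.
Proof. by case=> phi [iso stab _]; exists phi. Qed.

Lemma ext_cohomologous_of_eq (c c' : extension b) :
  (forall x y, c x y = c' x y) -> ext_cohomologous V c c'.
Proof.
by move=> eq_c; exists idfun; split=> //; split=> //; exists id.
Qed.

Lemma ext_equivalent_equivalence :
  Equivalence (@ext_equivalent k E G g b).
Proof.
split=> [c | c c' [phi [iso stab]]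
           | c1 c2 c3 [phi [iso stab]] [psi [iso' stab']]].
- by exists idfun; split=> //; split=> //; exists id.
- have [psi [_ _ iso' stab']] := stabilizing_iso_inverse iso stab.
  by exists psi.
- by exists (psi \o phi); exact: (stabilizing_iso_comp iso stab iso' stab').
Qed.

Lemma ext_cohomologous_equivalence :
  Equivalence (@ext_cohomologous k E G W g V b).
Proof.
split=> [c | c c' [phi [iso stab cost]]
           | c1 c2 c3 [phi [iso stab cost]] [psi [iso' stab' cost']]].
- exact: ext_cohomologous_of_eq.
- have [psi [_ psiK iso' stab']] := stabilizing_iso_inverse iso stab.
  by exists psi; split=> // e; rewrite -cost psiK.
- have [? ?] := stabilizing_iso_comp iso stab iso' stab'.
  by exists (psi \o phi); split=> // e; rewrite /= cost' cost.
Qed.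

Context (compGW : complement G W).
Let glueK : cancel (@glue k E G W g V) split_sum := glueK compGW.
Let split_sumK : cancel split_sum (@glue k E G W g V) := split_sumK compGW.

Lemma split_sum_valg (h : g) : split_sum (val h) = (h, 0 : V).
Proof. by rewrite -(glueK (h, 0)) /glue /= raddf0 addr0. Qed.

Lemma split_sum_valV (x : V) : split_sum (val x) = (0 : g, x).
Proof. by rewrite -(glueK (0, x)) /glue /= raddf0 add0r. Qed.

(** Conjugate the shear by [glue]. The last clause becomes co-stabilization when [v] is the
    identity. *)
Lemma transported_shear (O O' : LZ V b) (r : {linear V -> g})
    (v : {linear V -> V}) :
  bijective v -> shear_morphism O O' r v ->
  exists phi : {linear E -> E},
    [/\ leibniz_iso (unified_extension compGW O) (unified_extension compGW O')
          phi, stabilizes g phi &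
        forall e, proj (V := V) (g := g) (phi e) = v (proj (g := g) e)].
Proof.
move=> bij_v morph.
have lin : linear (fun e => glue (shear r v (split_sum e))).
  by move=> a e e'; rewrite split_sum_linear // shear_linear glue_linear.
have [phi phiE] := ex_linear lin.
exists phi; split; first split.
- have [s sK Ks] := shear_bij r bij_v.
  exists (fun e => glue (s (split_sum e))) => e; rewrite phiE glueK ?sK ?Ks.
    exact: split_sumK.
  exact: split_sumK.
- move=> e e'; rewrite !phiE /= /transported_bracket !glueK /=.
  by rewrite morph.
- move=> h; rewrite phiE split_sum_valg /shear /= !linear0 addr0.
  by rewrite -split_sum_valg split_sumK.
- by move=> e; rewrite phiE /proj glueK.
Qed.

(** The maps [r] and [v] are the two components of [phi] restricted to $V$; on $\mathfrak g$ there
    is nothing to choose. *)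
Lemma stabilizing_shear (phi : {linear E -> E}) : stabilizes g phi ->
  exists (r : {linear V -> g}) (v : {linear V -> V}),
    forall e, split_sum (phi e) = shear r v (split_sum e).
Proof.
move=> stab; pose s (x : V) : g * V := split_sum (phi (val x)).
have ls : linear s by move=> a x y; rewrite /s !linearP split_sum_linear.
have l1 : linear (fun x => (s x).1) by move=> a x y; rewrite ls.
have l2 : linear (fun x => (s x).2) by move=> a x y; rewrite ls.
have [r rE] := ex_linear l1; have [v vE] := ex_linear l2.
exists r, v => e; rewrite -{1}(split_sumK e).
case: (split_sum e) => h x; rewrite /glue /shear /= rE vE linearD stab.
(* The scalar 1 brings the sum into the form $au+w$ of [split_sum_linear]. *)
rewrite -[val h]scale1r split_sum_linear // split_sum_valg scale1r -/(s x).
by rewrite [LHS]surjective_pairing /= add0r.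
Qed.

Lemma shear_morphism_ext (O O' : LZ V b) (phi : E -> E) (r : V -> g)
    (v : V -> V) :
  (forall e, split_sum (phi e) = shear r v (split_sum e)) ->
  {morph phi : x y / unified_extension compGW O x y
     >-> unified_extension compGW O' x y} ->
  shear_morphism O O' r v.
Proof.
move=> phiE mor p q; have := mor (glue p) (glue q).
move/(congr1 (split_sum : E -> g * V)).
rewrite phiE /= /transported_bracket !glueK.
by rewrite !phiE !glueK.
Qed.

Lemma LZ_equiv_ext (O O' : LZ V b) :
  LZ_equiv O O' <->
  ext_equivalent (unified_extension compGW O) (unified_extension compGW O').
Proof.
rewrite LZ_equivP; split=> [[r [v [bij_v morph]]] |].
  by have [phi [iso stab _]] := transported_shear bij_v morph; exists phi.
move=> [phi [iso stab]].
have [psi [phiK psiK _ stab']] := stabilizing_iso_inverse iso stab.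
have [r [v phiE]] := stabilizing_shear stab.
have [r' [v' psiE]] := stabilizing_shear stab'.
exists r, v; split; last exact: shear_morphism_ext iso.2.
(* Bijectivity of [v]: through the surjection [p], the maps [v] and [v'] are induced by [phi] and
   its inverse [psi], hence are mutually inverse. *)
pose p : E -> V := proj (g := g).
have phi_p e : v (p e) = p (phi e) by rewrite /p /proj phiE.
have psi_p e : v' (p e) = p (psi e) by rewrite /p /proj psiE.
have p_val (x : V) : p (val x) = x by rewrite /p /proj split_sum_valV.
exists v' => x; rewrite -[in LHS](p_val x).
  by rewrite phi_p psi_p phiK p_val.
by rewrite psi_p phi_p psiK p_val.
Qed.

Lemma LZ_approx_ext (O O' : LZ V b) :
  LZ_approx O O' <->
  ext_cohomologous V (unified_extension compGW O) (unified_extension compGW O').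
Proof.
rewrite LZ_approxP; split=> [[r morph] | [phi [[bij mor] stab cost]]].
  have [|phi [iso stab cost]] := transported_shear _ morph; first by exists id.
  by exists phi.
have [r [v phiE]] := stabilizing_shear stab.
exists r; apply: (shear_morphism_ext _ mor) => e.
rewrite phiE /shear; congr pair.
(* Co-stabilization says that the $V$-component is unchanged, which lets the identity replace
   [v]. *)
by rewrite -[LHS]/((shear r v (split_sum e)).2) -phiE; exact: cost.
Qed.

(** The six maps are the components of [c] on $V\times\mathfrak g$, $\mathfrak g\times V$ and
    $V\times V$; on $\mathfrak g\times\mathfrak g$ the bracket is prescribed. *)
Lemma unified_extension_surj (c : extension b) :
  exists O : LZ V b, forall x y, unified_extension compGW O x y = c x y.
Proof.
have lin : linear (split_sum : E -> g * V) by exact: split_sum_linear.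
pose s (x y : E) : g * V := split_sum (c x y).
have sPl a x y z : s (a *: x + y) z = a *: s x z + s y z.
  by rewrite /s linearPl lin.
have sPr a x y z : s z (a *: x + y) = a *: s z x + s z y.
  by rewrite /s linearPr lin.
(* Stated for arbitrary subspaces, [bil1] and [bil2] each supply three of the six maps. *)
have bil1 (X Y : pred E) (A : subLmodType X) (B : subLmodType Y) :
    exists F : {bilinear A -> B -> g},
      forall x y, F x y = (s (val x) (val y)).1.
  by apply: ex_bilinear; split=> z a x y /=; rewrite linearP ?sPl ?sPr.
have bil2 (X Y : pred E) (A : subLmodType X) (B : subLmodType Y) :
    exists F : {bilinear A -> B -> V},
      forall x y, F x y = (s (val x) (val y)).2.
  by apply: ex_bilinear; split=> z a x y /=; rewrite linearP ?sPl ?sPr.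
have [rt rtE] := bil2 _ _ V g; have [lt ltE] := bil1 _ _ V g.
have [rh rhE] := bil1 _ _ g V; have [lh lhE] := bil2 _ _ g V.
have [f fE] := bil1 _ _ V V; have [vb vbE] := bil2 _ _ V V.
pose D := ExtendingDatum rt lt rh lh f vb.
have sDl x y z : s (x + y) z = s x z + s y z.
  by rewrite -[x]scale1r sPl !scale1r.
have sDr x y z : s z (x + y) = s z x + s z y.
  by rewrite -[x]scale1r sPr !scale1r.
(* The product built from [D] is [c] read in coordinates, so it inherits the Leibniz identity. *)
have DE p q : unified_bracket b D p q = s (glue p) (glue q).
  case: p q => [h x] [h' y].
  rewrite /unified_bracket /glue /= rtE ltE rhE lhE fE vbE sDl !sDr.
  have -> : s (val h) (val h') = (b h h', 0).
    by rewrite /s extensionP split_sum_valg.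
  rewrite [RHS]surjective_pairing; congr pair => /=; rewrite ?add0r !addrA.
    by rewrite [RHS](ACl (1*3*2*4)%AC).
  by rewrite [LHS](ACl (3*2*1)%AC).
have DP : leibniz_id (unified_bracket b D).
  move=> p q t; rewrite !DE /s !split_sumK (leibnizP c).
  by rewrite -scaleN1r addrC lin addrC scaleN1r.
exists (LeibnizExtending DP) => x y.
by rewrite /= /transported_bracket /= DE !split_sumK.
Qed.

End Extensions.

Theorem theorem2p9 (k : fieldType) (E : lmodType k)
    (G : pred E) (g : subLmodType G) (b : leibniz g)
    (W : pred E) (V : subLmodType W) (compGW : complement G W) :
  (Equivalence (@LZ_equiv k g V b) /\
   exists F : HL2g V b -> ExtdL b,
     (forall O : LZ V b,
        F (class_of (@LZ_equiv k g V b) O)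
        = class_of ext_equivalent (unified_extension compGW O))
     /\ bijective F)
  /\
  (Equivalence (@LZ_approx k g V b) /\
   exists F : HL2 V b -> ExtdL' V b,
     (forall O : LZ V b,
        F (class_of (@LZ_approx k g V b) O)
        = class_of (ext_cohomologous V) (unified_extension compGW O))
     /\ bijective F).
Proof.
(* Surjectivity is shown for the finer relation, cohomology, and passes to equivalence. *)
have surj (c : extension b) :
    exists O : LZ V b, ext_cohomologous V (unified_extension compGW O) c.
  have [O OE] := unified_extension_surj (V := V) compGW c.
  by exists O; exact: ext_cohomologous_of_eq.
split.
  apply: (quotient_bijection ext_equivalent_equivalence
    (LZ_equiv_ext (V := V) compGW)).
  by move=> c; have [O /cohomologous_equivalent] := surj c; exists O.
exact: (quotient_bijection ext_cohomologous_equivalence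
  (LZ_approx_ext (V := V) compGW)).
Qed.
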